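(* For all integers $n\geq 0$ and $k\geq 1$, \[ C_k(n+1)=\sum_{i=0}^n\binom{n}{i} E_k(i), \] where $C_k(m)$ denotes the number of set partitions of $[m]=\{1,\ldots,m\}$ with no classical $k$-crossing, and $E_k(m)$ denotes the number of set partitions of $[m]$ with no enhanced $k$-crossing.
   Context: Let $\pi$ be a set partition of a finite totally ordered set. A pair $a<b$ is said to appear consecutively in a block of $\pi$ if $a$ and $b$ lie in the same block and there is no element $x$ of that block with $a<x<b$. An enhanced $k$-crossing of $\pi$ is a sequence $a_1<a_2<\cdots<a_k\leq b_1<b_2<\cdots<b_k$ such that for each $i$, the pair $a_i<b_i$ appears consecutively in a block of $\pi$ (when $a_k=b_1$, the pair $a_k<b_k$ and $a_1<b_1$ still must be distinct consecutive pairs as described; for $k=1$ an enhanced $1$-crossing is interpreted as a pair $a_1\le b_1$ with either $a_1<b_1$ consecutive in a block, or $a_1=b_1$ a singleton block). A classical $k$-crossing is an enhanced $k$-crossing which additionally satisfies $a_k<b_1$. By convention $[0]=\emptyset$ and $C_k(0)=E_k(0)=1$ for the empty partition. *)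

(* Defs.v *)
From HB Require Import structures.
From mathcomp Require Import all_boot all_order.
Set Implicit Arguments.
Unset Strict Implicit.
Unset Printing Implicit Defensive.

Local Open Scope order_scope.

Definition consecutive (d : Order.disp_t) (T : finOrderType d)
    (P : {set {set T}}) (x y : T) : bool :=
  [exists B in P, [&& x \in B, y \in B, x < y
                    & [forall z in B, ~~ ((x < z) && (z < y))]]].

(* The second disjunct is the convention for enhanced 1-crossings: a singleton
   block {x} counts as the 1-crossing x <= x. *)
Definition crossing_pair (d : Order.disp_t) (T : finOrderType d) (k : nat)
    (P : {set {set T}}) (x y : T) : bool :=
  consecutive P x y || [&& k == 1%N, x == y & [set x] \in P].

(* Indices are 0-based: the conditions i.+1 = k and j = 0 select a_k and b_1. *)
Definition enhanced_crossing (d : Order.disp_t) (T : finOrderType d) (k : nat)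
    (P : {set {set T}}) (a b : {ffun 'I_k -> T}) : bool :=
  [&& [forall i : 'I_k, forall j : 'I_k, (i < j)%N ==> (a i < a j)],
      [forall i : 'I_k, forall j : 'I_k, (i < j)%N ==> (b i < b j)],
      [forall i : 'I_k, forall j : 'I_k,
         (i.+1 == k) && (j == 0 :> nat) ==> (a i <= b j)]
    & [forall i : 'I_k, crossing_pair k P (a i) (b i)]].

Definition classical_crossing (d : Order.disp_t) (T : finOrderType d) (k : nat)
    (P : {set {set T}}) (a b : {ffun 'I_k -> T}) : bool :=
  enhanced_crossing P a b &&
  [forall i : 'I_k, forall j : 'I_k,
     (i.+1 == k) && (j == 0 :> nat) ==> (a i < b j)].

Definition has_enhanced_crossing (d : Order.disp_t) (T : finOrderType d)
    (k : nat) (P : {set {set T}}) : bool :=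
  [exists a : {ffun 'I_k -> T}, exists b : {ffun 'I_k -> T},
     enhanced_crossing P a b].

Definition has_classical_crossing (d : Order.disp_t) (T : finOrderType d)
    (k : nat) (P : {set {set T}}) : bool :=
  [exists a : {ffun 'I_k -> T}, exists b : {ffun 'I_k -> T},
     classical_crossing P a b].

(* [m] = {1, ..., m} is represented by 'I_m = {0, ..., m - 1}. *)
Definition classical_noncrossing_count (k m : nat) : nat :=
  #|[set P : {set {set 'I_m}} |
      partition P [set: 'I_m] & ~~ has_classical_crossing k P]|.

Definition enhanced_noncrossing_count (k m : nat) : nat :=
  #|[set P : {set {set 'I_m}} |
      partition P [set: 'I_m] & ~~ has_enhanced_crossing k P]|.

(* Main.v *)
(** A partition of a finite ordered set is determined by its arcs, the pairs
    that are consecutive in a block; the arc sets that occur are exactly those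
    in which every arc (a, b) has a < b, and every point starts at most one arc
    and ends at most one arc.  Moving the right end of every arc of a partition
    of [n+1] one step to the left gives such a diagram on [n] in which loops are
    allowed, and it turns the condition a_k < b_1 into a_k <= b_1.  A point
    carrying a loop meets no other arc.  Hence, if S is the set of points met by
    some arc or loop, the diagram is a partition of S whose singleton blocks are
    the loops, and classical k-crossings have become enhanced ones.  Summing
    over S gives the binomial formula. *)

Require Import Defs.
From mathcomp Require Import all_boot all_order.

Set Implicit Arguments.
Unset Strict Implicit.
Unset Printing Implicit Defensive.

Import Order.TTheory.

Local Open Scope order_scope.

(** * Bijective counting and paths of a deterministic relation *)

Lemma card_in_can (aT rT : finType) (A : {set aT}) (B : {set rT})
    (f : aT -> rT) (g : rT -> aT) :
  {in A, forall x, f x \in B} -> {in B, forall y, g y \in A} ->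
  {in A, cancel f g} -> {in B, cancel g f} -> #|A| = #|B|.
Proof.
move=> fAB gBA fK gK.
rewrite -(card_in_imset (can_in_inj fK)); apply: eq_card => y.
apply/imsetP/idP => [[x Ax ->]|By]; first exact: fAB.
by exists (g y); [exact: gBA | rewrite gK].
Qed.

(** Each vertex has at most one successor, so two paths from [x] take the same steps until the
    shorter one stops; the longer one then continues from there. *)
Lemma connect_fork (T : finType) (e : rel T) :
  (forall x y z, e x y -> e x z -> y = z) ->
  forall x y z, connect e x y -> connect e x z ->
  connect e y z || connect e z y.
Proof.
move=> det x y z /connectP[p]; elim: p x => [|w p IH] x /=.
  by move=> _ -> ->.
case/andP=> xw pw yE /connectP[[|v q]] /=.
  move=> _ ->; apply/orP; right; apply: connect_trans (connect1 xw) _.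
  by rewrite yE; apply/connectP; exists p.
case/andP=> xv qv zE; rewrite -(det _ _ _ xw xv) in qv zE.
by apply: IH pw yE _; apply/connectP; exists q.
Qed.

(** * Arc diagrams and their supports *)

(** The relation [r] is [<] for the arcs of a partition and [<=] once loops are allowed. The
    equality of the two tests bundles uniqueness of outgoing and of incoming arcs. *)
Definition diagram (T : finType) (r : rel T) (A : {set T * T}) : bool :=
  [forall p in A, r p.1 p.2] &&
  [forall p in A, forall q in A, (p.1 == q.1) == (p.2 == q.2)].

Lemma diagramP (T : finType) (r : rel T) (A : {set T * T}) :
  reflect [/\ forall x y, (x, y) \in A -> r x y,
              forall x y z, (x, y) \in A -> (x, z) \in A -> y = z
            & forall x y z, (x, z) \in A -> (y, z) \in A -> x = y]
          (diagram r A).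
Proof.
apply: (iffP andP) => [[/forall_inP rA /forall_inP uA]|[rA out inc]].
  split=> [x y /rA //|x y z Axy Axz|x y z Axz Ayz].
    by move/forall_inP: (uA _ Axy) => /(_ _ Axz) /=; rewrite eqxx eq_sym => /eqP/eqP.
  by move/forall_inP: (uA _ Axz) => /(_ _ Ayz) /=; rewrite eqxx => /eqP/eqP.
split; first by apply/forall_inP => -[x y] /rA.
apply/forall_inP => -[x y] Axy; apply/forall_inP => -[z t] Azt /=.
apply/eqP; apply/idP/idP => /eqP E; rewrite E in Axy; apply/eqP.
  exact: out Axy Azt.
exact: inc Axy Azt.
Qed.

Definition support (T : finType) (A : {set T * T}) : {set T} :=
  [set x | [exists y, ((x, y) \in A) || ((y, x) \in A)]].

Lemma mem_supportl (T : finType) (A : {set T * T}) (x y : T) :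
  (x, y) \in A -> x \in support A.
Proof. by move=> Axy; rewrite inE; apply/existsP; exists y; rewrite Axy. Qed.

Lemma mem_supportr (T : finType) (A : {set T * T}) (x y : T) :
  (x, y) \in A -> y \in support A.
Proof. by move=> Axy; rewrite inE; apply/existsP; exists x; rewrite Axy orbT. Qed.

Lemma supportP (T : finType) (A : {set T * T}) (x : T) :
  reflect (exists y, (x, y) \in A \/ (y, x) \in A) (x \in support A).
Proof.
rewrite inE; apply: (iffP existsP) => -[y Ay]; exists y; first exact/orP.
exact/orP.
Qed.

(** * Set partitions correspond to strict diagrams *)

Definition arcs (d : Order.disp_t) (T : finOrderType d) (P : {set {set T}}) :
    {set T * T} :=
  [set p | consecutive P p.1 p.2].

(** A component of a strict diagram is an increasing path, so of two of its points one is always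
    reachable from the other. *)
Definition same_component (T : finType) (A : {set T * T}) : rel T :=
  fun x y => connect (fun u v => (u, v) \in A) x y ||
             connect (fun u v => (u, v) \in A) y x.

Definition components (T : finType) (A : {set T * T}) : {set {set T}} :=
  equivalence_partition (same_component A) [set: T].

Lemma consecutiveE (d : Order.disp_t) (T : finOrderType d) (P : {set {set T}})
    (x y : T) : partition P [set: T] ->
  consecutive P x y =
    [&& y \in pblock P x, x < y &
        [forall z in pblock P x, ~~ ((x < z) && (z < y))]].
Proof.
case/and3P=> /eqP covP tiP _.
apply/exists_inP/idP => [[B PB /and4P[xB yB xy H]]|/and3P[xy lt H]].
  by rewrite (def_pblock tiP PB xB) yB xy.
exists (pblock P x); first by rewrite pblock_mem ?covP ?inE.
by rewrite mem_pblock covP inE xy lt.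
Qed.

(** If [x] had two successors in its block, the smaller would lie strictly between [x] and the
    larger; predecessors are treated dually. *)
Lemma arcs_diagram (d : Order.disp_t) (T : finOrderType d) (P : {set {set T}}) :
  partition P [set: T] -> diagram <%O (arcs P).
Proof.
move=> pP; have [/eqP covP tiP _] := and3P pP.
apply/diagramP; split=> [x y|x y z|x y z]; rewrite !inE /= !consecutiveE //.
- by case/and3P.
- move=> /and3P[yB xy /forall_inP Hy] /and3P[zB xz /forall_inP Hz].
  move: (Hy z zB) (Hz y yB); rewrite xy xz /= -!leNgt => yz zy.
  by apply/eqP; rewrite eq_le yz zy.
move=> /and3P[zx xz Hx] /and3P[zy yz Hy].
have Exy : pblock P x = pblock P y.
  by rewrite -(same_pblock tiP zx) -(same_pblock tiP zy).
have xB : x \in pblock P x by rewrite mem_pblock covP.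
have yB : y \in pblock P y by rewrite mem_pblock covP.
rewrite -Exy in yB Hy.
move/forall_inP: Hx => /(_ y yB); move/forall_inP: Hy => /(_ x xB).
rewrite xz yz !andbT -!leNgt => xy yx.
by apply/eqP; rewrite eq_le xy yx.
Qed.

Lemma connect_diagram_le (d : Order.disp_t) (T : finOrderType d)
    (A : {set T * T}) (x y : T) : diagram <%O A ->
  connect (fun u v => (u, v) \in A) x y -> x <= y.
Proof.
case/diagramP=> ltA _ _ /connectP[p]; elim: p x => [|z p IH] x /= => [_ -> //|].
case/andP=> /ltA xz pz yE; exact: le_trans (ltW xz) (IH _ pz yE).
Qed.

Lemma same_component_equivalence (d : Order.disp_t) (T : finOrderType d)
    (A : {set T * T}) : diagram <%O A ->
  {in [set: T] & &, equivalence_rel (same_component A)}.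
Proof.
case/diagramP=> _ out inc.
have sC x y : same_component A x y = same_component A y x by rewrite /same_component orbC.
have tr x y z : same_component A x y -> same_component A y z -> same_component A x z.
  rewrite /same_component.
  case/orP=> xy /orP[yz|zy].
  - by rewrite (connect_trans xy yz).
  (* Both paths end at [y], so the fork lemma is applied to the reversed arcs: a point ends at most
     one arc. *)
  - have H := @connect_fork _ [rel u v | (v, u) \in A]
      (fun x0 y0 z0 h1 h2 => inc _ _ _ h1 h2) y x z.
    by rewrite !connect_rev /= in H; rewrite orbC; apply: H.
  - exact: (connect_fork out xy yz).
  - by rewrite (connect_trans zy xy) orbT.
move=> x y z _ _ _; split; first by rewrite /same_component connect0.
move=> xy; apply/idP/idP; last exact: tr xy.
by rewrite sC in xy; exact: tr.
Qed.

Lemma components_partition (d : Order.disp_t) (T : finOrderType d)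
    (A : {set T * T}) : diagram <%O A -> partition (components A) [set: T].
Proof. by move=> dA; apply/equivalence_partitionP/same_component_equivalence. Qed.

Lemma mem_pblock_components (d : Order.disp_t) (T : finOrderType d)
    (A : {set T * T}) (x y : T) : diagram <%O A ->
  (y \in pblock (components A) x) = same_component A x y.
Proof.
move=> dA.
by apply: (pblock_equivalence_partition (same_component_equivalence dA));
  rewrite inE.
Qed.

(** Paths increase, and every nontrivial path from [x] begins with the only arc out of [x]; the end
    of that arc is therefore the next point of the component. *)
Lemma componentsK (d : Order.disp_t) (T : finOrderType d) (A : {set T * T}) :
  diagram <%O A -> arcs (components A) = A.
Proof.
move=> dA; apply/setP => -[x y]; rewrite !inE /=.
rewrite consecutiveE ?components_partition // mem_pblock_components //.
have [ltA out inc] := diagramP _ _ dA.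
have first_step u v : u < v -> same_component A u v ->
    exists2 w, (u, w) \in A & w <= v.
  move=> uv /orP[|/(connect_diagram_le dA)]; last by rewrite leNgt uv.
  case/connectP=> -[|w p] /=; first by move=> _ E; rewrite E ltxx in uv.
  case/andP=> uw pw vE; exists w => //.
  by apply: (connect_diagram_le dA); apply/connectP; exists p.
apply/and3P/idP => [[xy lt_xy /forall_inP nz]|Axy].
  have [w Axw wy] := first_step _ _ lt_xy xy.
  have: ~~ ((x < w) && (w < y)).
    by apply: nz; rewrite mem_pblock_components // /same_component connect1.
  rewrite (ltA _ _ Axw) /= -leNgt => yw.
  by have -> : y = w by apply/eqP; rewrite eq_le yw wy.
split; [by rewrite /same_component connect1|exact: ltA|].
apply/forall_inP => z; rewrite mem_pblock_components // => xz.
apply/negP=> /andP[lt_xz lt_zy].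
have [w Axw wz] := first_step _ _ lt_xz xz.
by move: wz; rewrite (out _ _ _ Axw Axy) leNgt lt_zy.
Qed.

Lemma arcsK (d : Order.disp_t) (T : finOrderType d) (P : {set {set T}}) :
  partition P [set: T] -> components (arcs P) = P.
Proof.
move=> pP; have [/eqP covP tiP _] := and3P pP.
rewrite -[RHS](equivalence_partition_pblock pP) /components.
have Bxx x : x \in pblock P x by rewrite mem_pblock covP.
suff E : same_component (arcs P) =2 (fun x y => y \in pblock P x).
  apply: eq_imset => x; apply/setP => y; rewrite !inE; exact: E.
have connB x y : connect (fun u v => (u, v) \in arcs P) x y -> pblock P x = pblock P y.
  case/connectP=> p; elim: p x => [|z p IH] x /= => [_ -> //|].
  case/andP; rewrite inE consecutiveE //= => /and3P[zx _ _] pz yE.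
  by rewrite -(IH z pz yE) (same_pblock tiP zx).
(* Induction on the number of points above [x]: there is an arc from [x] to [z], the least larger
   point of its block, and [y] is reached from [z]. *)
have Bconn x y : x < y -> y \in pblock P x -> connect (fun u v => (u, v) \in arcs P) x y.
  have [m] := ubnP #|[set z | x < z]|; elim: m x => // m IH x ltm xy By.
  pose Q z := (z \in pblock P x) && (x < z).
  have Qy : Q y by rewrite /Q By.
  case: (Order.TotalTheory.arg_minP id Qy) => z /andP[Bz xz] minz.
  have Axz : (x, z) \in arcs P.
    rewrite inE consecutiveE //= Bz xz /=; apply/forall_inP => t Bt.
    by apply/negP=> /andP[xt]; rewrite ltNge minz // /Q Bt.
  apply: connect_trans (connect1 Axz) _.
  have [-> //|neq] := eqVneq z y; apply: IH.
  - move: ltm; rewrite ltnS; apply: leq_trans; apply: proper_card; apply/properP; split.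
      by apply/subsetP => t; rewrite !inE; apply: lt_trans.
    by exists z; rewrite !inE ?ltxx.
  - by rewrite lt_neqAle neq minz.
  - by rewrite (same_pblock tiP Bz).
move=> x y; apply/idP/idP.
  by case/orP=> /connB E; [rewrite E|rewrite -E].
move=> By; rewrite /same_component; case: (ltgtP x y) => [xy|yx|->].
- by rewrite Bconn.
- by rewrite [X in _ || X]Bconn ?orbT // (same_pblock tiP By).
- by rewrite connect0.
Qed.

Lemma card_partition_arcs (d : Order.disp_t) (T : finOrderType d)
    (Q : pred {set {set T}}) (Q' : pred {set T * T}) :
  (forall P, partition P [set: T] -> Q P = Q' (arcs P)) ->
  #|[set P | partition P [set: T] & Q P]| =
  #|[set A | diagram <%O A & Q' A]|.
Proof.
move=> QQ'; apply: (@card_in_can _ _ _ _ (@arcs _ T) (@components T)).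
- by move=> P /[!inE] /andP[pP QP]; rewrite arcs_diagram // -QQ'.
- by move=> A /[!inE] /andP[dA QA]; rewrite components_partition // QQ'
    ?componentsK ?components_partition.
- by move=> P /[!inE] /andP[pP _]; apply: arcsK.
- by move=> A /[!inE] /andP[dA _]; apply: componentsK.
Qed.

(** * Crossings read off from diagrams *)

(** Here [r] compares a_k with b_1: [<] gives classical crossings and [<=] enhanced ones. *)
Definition kcrossing (d : Order.disp_t) (T : finOrderType d) (k : nat)
    (r : rel T) (A : {set T * T}) : bool :=
  [exists a : {ffun 'I_k -> T}, exists b : {ffun 'I_k -> T},
   [&& [forall i : 'I_k, forall j : 'I_k, (i < j)%N ==> (a i < a j)],
       [forall i : 'I_k, forall j : 'I_k, (i < j)%N ==> (b i < b j)],
       [forall i : 'I_k, forall j : 'I_k,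
          (i.+1 == k) && (j == 0 :> nat) ==> r (a i) (b j)]
     & [forall i : 'I_k, (a i, b i) \in A]]].

Lemma kcrossingP (d : Order.disp_t) (T : finOrderType d) (k : nat)
    (r : rel T) (A : {set T * T}) :
  reflect (exists a b : 'I_k -> T,
             [/\ {homo a : i j / (i < j)%N >-> i < j},
                 {homo b : i j / (i < j)%N >-> i < j},
                 forall i j : 'I_k, i.+1 = k -> j = 0 :> nat -> r (a i) (b j)
               & forall i, (a i, b i) \in A])
          (kcrossing k r A).
Proof.
apply: (iffP existsP) => [[a /existsP[b /and4P[Ha Hb Hr HA]]]|[a [b [Ha Hb Hr HA]]]].
  exists a, b; split=> [i j ij|i j ij|i j ik j0|i].
  - by move/forallP/(_ i)/forallP/(_ j): Ha; rewrite ij.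
  - by move/forallP/(_ i)/forallP/(_ j): Hb; rewrite ij.
  - by move/forallP/(_ i)/forallP/(_ j): Hr; rewrite ik j0 !eqxx.
  - by move/forallP: HA.
exists (finfun a); apply/existsP; exists (finfun b); apply/and4P; split.
- by apply/forallP=> i; apply/forallP=> j; apply/implyP=> /Ha; rewrite !ffunE.
- by apply/forallP=> i; apply/forallP=> j; apply/implyP=> /Hb; rewrite !ffunE.
- apply/forallP=> i; apply/forallP=> j; apply/implyP=> /andP[/eqP ik /eqP j0].
  by rewrite !ffunE; apply: Hr.
- by apply/forallP=> i; rewrite !ffunE.
Qed.

(** The convention on singleton blocks concerns only k = 1 and gives a_1 = b_1, which the strict
    condition a_k < b_1 excludes. *)
Lemma has_classical_crossingE (d : Order.disp_t) (T : finOrderType d) (k : nat)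
    (P : {set {set T}}) : has_classical_crossing k P = kcrossing k <%O (arcs P).
Proof.
apply: eq_existsb => a; apply: eq_existsb => b.
apply/andP/and4P => [[/and4P[Ha Hb _ HP] Hlt]|[Ha Hb Hlt HP]].
  split=> //; apply/forallP=> i; rewrite inE /=.
  move/forallP/(_ i): HP => /orP[//|/and3P[/eqP k1 /eqP abi _]].
  have i0 : i = 0 :> nat by case: (i) (ltn_ord i) => /= m _; rewrite k1; case: m.
  move/forallP/(_ i)/forallP/(_ i): Hlt.
  rewrite abi ltxx; suff -> : (i.+1 == k) && (i == 0 :> nat) by [].
  by rewrite i0 eq_sym k1.
split=> //; apply/and4P; split=> //.
  apply/forallP=> i; apply/forallP=> j; apply/implyP=> ij.
  by move/forallP/(_ i)/forallP/(_ j): Hlt; rewrite ij => /ltW.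
by apply/forallP=> i; move/forallP/(_ i): HP; rewrite inE /crossing_pair => ->.
Qed.

(** * Loops as singleton blocks *)

(** For the arcs of a partition, the points off the support are the singleton blocks; a loop on each
    makes the support full. *)
Definition add_loops (T : finType) (A : {set T * T}) : {set T * T} :=
  [set p | (p \in A) || ((p.1 == p.2) && (p.1 \notin support A))].

Definition drop_loops (T : finType) (A : {set T * T}) : {set T * T} :=
  [set p in A | p.1 != p.2].

Lemma connect_support (T : finType) (A : {set T * T}) (x y : T) :
  x != y -> connect (fun u v => (u, v) \in A) x y ->
  (x \in support A) && (y \in support A).
Proof.
move=> xy /connectP[p pp yE]; apply/andP; split.
  case: p pp yE => [_ E|z p /= /andP[Axz _] _]; last exact: mem_supportl Axz.
  by rewrite E eqxx in xy.
case/lastP: p pp yE => [_ E|p z]; first by rewrite E eqxx in xy.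
by rewrite rcons_path last_rcons => /andP[_ Az] ->; apply: mem_supportr Az.
Qed.

(** The block of [x] is its component, and a path joining [x] to another point uses an arc at
    [x]. *)
Lemma singleton_block (d : Order.disp_t) (T : finOrderType d)
    (P : {set {set T}}) (x : T) : partition P [set: T] ->
  ([set x] \in P) = (x \notin support (arcs P)).
Proof.
move=> pP; have [/eqP covP tiP _] := and3P pP; have dP := arcs_diagram pP.
have [ltA _ _] := diagramP _ _ dP.
have BE u v : (v \in pblock P u) = same_component (arcs P) u v.
  by rewrite -(mem_pblock_components _ _ dP) arcsK.
apply/idP/idP => [Px|xA].
  have Bx : pblock P x = [set x] by rewrite (def_pblock tiP Px) ?set11.
  apply/supportP=> -[y [Axy|Ayx]].
    have: y \in pblock P x by rewrite BE /same_component connect1.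
    by rewrite Bx inE => /eqP E; move: (ltA _ _ Axy); rewrite E ltxx.
  have: y \in pblock P x by rewrite BE /same_component orbC connect1.
  by rewrite Bx inE => /eqP E; move: (ltA _ _ Ayx); rewrite E ltxx.
suff <- : pblock P x = [set x] by rewrite pblock_mem ?covP.
apply/setP=> y; rewrite BE inE; apply/idP/eqP => [xy|->]; last first.
  by rewrite /same_component connect0.
apply/eqP; apply: contraNT xA; rewrite eq_sym => neq.
case/orP: xy => /connect_support; first by move/(_ neq)/andP=> [].
by rewrite eq_sym => /(_ neq)/andP[].
Qed.

(* A loop can only take part in a weak k-crossing when k = 1, because
   a_i <= a_k <= b_1 <= b_i is strict as soon as i <> k or i <> 1. *)
Lemma has_enhanced_crossingE (d : Order.disp_t) (T : finOrderType d) (k : nat)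
    (P : {set {set T}}) : partition P [set: T] ->
  has_enhanced_crossing k P = kcrossing k <=%O (add_loops (arcs P)).
Proof.
move=> pP; apply: eq_existsb => a; apply: eq_existsb => b.
have E i : ((a i, b i) \in add_loops (arcs P)) =
    consecutive P (a i) (b i) || (a i == b i) && ([set a i] \in P).
  by rewrite singleton_block // !inE.
apply/and4P/and4P => -[Ha Hb Hle HP]; split=> //; apply/forallP=> i;
  move/forallP/(_ i): (HP); rewrite E /crossing_pair.
  by case/orP=> [->//|/and3P[_ -> ->]]; rewrite orbT.
case/orP=> [->//|/andP[abi ->]]; rewrite abi andbT /= andbT.
have k_gt0 : (0 < k)%N by apply: leq_ltn_trans (ltn_ord i).
have kk : (k.-1 < k)%N by rewrite prednK.
(* [l] is the index of a_k and [f] that of b_1. *)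
pose l := Ordinal kk; pose f := Ordinal k_gt0.
have lf : a l <= b f.
  by move/forallP/(_ l)/forallP/(_ f): Hle; rewrite /= prednK // !eqxx.
have [il|li] := ltnP i l.
  move/forallP/(_ i)/forallP/(_ l): Ha; rewrite il /= => ail.
  have bfi : b f <= b i.
    have [fi|] := ltnP f i.
      by move/forallP/(_ f)/forallP/(_ i): Hb; rewrite fi => /ltW.
    by rewrite leqn0 => /eqP i0; have -> : i = f by apply: val_inj.
  by have := lt_le_trans ail (le_trans lf bfi); rewrite (eqP abi) ltxx.
have iE : i = l.
  by apply/val_inj/eqP; rewrite eqn_leq li andbT /= -ltnS prednK ?ltn_ord.
have [fi|] := ltnP f i.
  move/forallP/(_ f)/forallP/(_ i): Hb; rewrite fi /= => bfi.
  by have := le_lt_trans lf bfi; rewrite -iE (eqP abi) ltxx.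
rewrite leqn0 iE /= => k1.
by apply/orP; right; rewrite -[X in X == _](prednK k_gt0) (eqP k1).
Qed.

(** Dropping loops inverts adding them: in a weak diagram a looped point meets no other arc, so when
    the support is full the loops sit exactly at the points that no strict arc meets. *)
Lemma card_full_diagram (d : Order.disp_t) (T : finOrderType d)
    (Q : pred {set T * T}) :
  #|[set A | diagram <%O A & Q (add_loops A)]| =
  #|[set W | [&& diagram <=%O W, Q W & support W == [set: T]]]|.
Proof.
have addK (A : {set T * T}) : diagram <%O A -> drop_loops (add_loops A) = A.
  case/diagramP=> ltA _ _; apply/setP=> -[x y]; rewrite !inE /=.
  have [->|] := eqVneq x y; last by rewrite andbT orbF.
  by rewrite andbF; apply/esym/negP=> /ltA; rewrite ltxx.
have dropK (W : {set T * T}) : diagram <=%O W -> support W = [set: T] ->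
    add_loops (drop_loops W) = W.
  case/diagramP=> leW out inc sW; apply/setP=> -[x y]; rewrite !inE /= -!/(support _).
  have [<-{y}|neq] := eqVneq x y; last by rewrite andbT orbF.
  rewrite andbF /=; apply/idP/idP => [nx|Wxx].
    have: x \in support W by rewrite sW.
    case/supportP=> y Wy; have [E|neq] := eqVneq x y; first by case: Wy; rewrite -E.
    case/negP: nx; apply/existsP; exists y; rewrite !inE /=.
    by rewrite neq eq_sym neq !andbT; apply/orP.
  apply/existsP=> -[y]; rewrite !inE /= => /orP[/andP[Wxy]|/andP[Wyx]].
    by rewrite (out _ _ _ Wxx Wxy) eqxx.
  by rewrite (inc _ _ _ Wyx Wxx) eqxx.
apply: (@card_in_can _ _ _ _ (@add_loops T) (@drop_loops T)).
- move=> A; rewrite !inE => /andP[dA ->] /=; have [ltA out inc] := diagramP _ _ dA.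
  apply/andP; split; last first.
    apply/eqP/setP=> x; rewrite [RHS]inE; case xA: (x \in support A).
      case/supportP: xA => y [Axy|Ayx].
        by apply: (@mem_supportl _ _ x y); rewrite inE Axy.
      by apply: (@mem_supportr _ _ y x); rewrite inE Ayx.
    by apply: (@mem_supportl _ _ x x); rewrite inE /= eqxx xA orbT.
  apply/diagramP; split=> [x y|x y z|x y z]; rewrite ![_ \in add_loops _]inE /=.
  + by case/orP=> [/ltA/ltW //|/andP[/eqP->]].
  (* An arc and an added loop never share an end, since added loops lie off the support. *)
  + case/orP=> [Axy|/andP[/eqP<- xA]]; case/orP=> [Axz|/andP[/eqP E xA']].
    * exact: out Axy Axz.
    * by rewrite (mem_supportl Axy) in xA'.
    * by rewrite (mem_supportl Axz) in xA.
    * by [].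
  + case/orP=> [Axz|/andP[/eqP-> xA]]; case/orP=> [Ayz|/andP[/eqP E yA]].
    * exact: inc Axz Ayz.
    * by rewrite E (mem_supportr Axz) in yA.
    * by rewrite (mem_supportr Ayz) in xA.
    * by [].
- move=> W; rewrite !inE => /and3P[dW QW /eqP sW]; rewrite dropK // QW andbT.
  have [leW out inc] := diagramP _ _ dW.
  apply/diagramP; split=> [x y|x y z|x y z]; rewrite !inE /=.
  + by case/andP=> /leW; rewrite lt_neqAle => -> ->.
  + by case/andP=> Wxy _ /andP[Wxz _]; apply: out Wxy Wxz.
  + by case/andP=> Wxz _ /andP[Wyz _]; apply: inc Wxz Wyz.
- by move=> A; rewrite inE => /andP[dA _]; apply: addK.
- by move=> W; rewrite inE => /and3P[dW _ /eqP sW]; apply: dropK.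
Qed.

(** * Transport of diagrams along maps *)

(** Left and right ends get separate maps, so that right ends can be shifted relative to left
    ends. *)
Definition map_arcs (T T' : finType) (u v : T -> T') (A : {set T * T}) :
    {set T' * T'} :=
  [set (u p.1, v p.2) | p in A].

Lemma mem_map_arcs (T T' : finType) (u v : T -> T') (A : {set T * T}) x y :
  injective u -> injective v -> ((u x, v y) \in map_arcs u v A) = ((x, y) \in A).
Proof.
move=> uI vI; rewrite -[(u x, v y)]/((fun p => (u p.1, v p.2)) (x, y)) mem_imset //.
by move=> [a b] [a' b'] /= [/uI-> /vI->].
Qed.

Lemma diagram_map (T T' : finType) (u v : T -> T') (r : rel T) (r' : rel T')
    (A : {set T * T}) :
  injective u -> injective v -> (forall x y, r' (u x) (v y) = r x y) ->
  diagram r' (map_arcs u v A) = diagram r A.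
Proof.
move=> uI vI rr'; apply/diagramP/diagramP => -[rA out inc].
  split=> [x y|x y z|x y z]; rewrite -!(mem_map_arcs _ _ _ uI vI).
  - by move/rA; rewrite rr'.
  - by move=> h1 h2; apply/vI; apply: out h1 h2.
  - by move=> h1 h2; apply/uI; apply: inc h1 h2.
split=> [x y|x y z|x y z].
- by case/imsetP=> -[x0 y0] A0 [-> ->]; rewrite rr'; apply: rA.
- case/imsetP=> -[x0 y0] A0 [-> ->] /imsetP[[x1 y1] A1 [/uI E ->]] /=.
  by rewrite -E in A1; rewrite /= (out _ _ _ A0 A1).
- case/imsetP=> -[x0 y0] A0 [-> ->] /imsetP[[x1 y1] A1 [-> /vI E]] /=.
  by rewrite -E in A1; rewrite /= (inc _ _ _ A0 A1).
Qed.

(** Left ends are compared among themselves, and so are right ends; the only mixed comparison, of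
    a_k with b_1, goes through [r]. *)
Lemma kcrossing_map (d d' : Order.disp_t) (T : finOrderType d)
    (T' : finOrderType d') (k : nat) (u v : T -> T') (r : rel T) (r' : rel T')
    (A : {set T * T}) :
  {mono u : x y / x <= y} -> {mono v : x y / x <= y} ->
  (forall x y, r' (u x) (v y) = r x y) ->
  kcrossing k r' (map_arcs u v A) = kcrossing k r A.
Proof.
move=> um vm rr'.
have uI := inc_inj um.
have vI := inc_inj vm.
apply/kcrossingP/kcrossingP => -[a [b [Ha Hb Hr HA]]]; last first.
  exists (u \o a), (v \o b); split=> [i j /Ha|i j /Hb|i j ik j0|i] /=.
  - by rewrite (leW_mono um).
  - by rewrite (leW_mono vm).
  - by rewrite rr'; apply: Hr.
  - by rewrite mem_map_arcs.
(* Each pair is pulled back as a whole, so that both of its ends come from one element of [A]. *)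
have /fin_all_exists[p Hp] i : exists p : T * T,
    [/\ p \in A, a i = u p.1 & b i = v p.2].
  by case/imsetP: (HA i) => p Ap [-> ->]; exists p.
exists (fun i => (p i).1), (fun i => (p i).2).
split=> [i j /Ha|i j /Hb|i j ik j0|i] /=.
- by case: (Hp i) (Hp j) => _ -> _ [_ -> _]; rewrite (leW_mono um).
- by case: (Hp i) (Hp j) => _ _ -> [_ _ ->]; rewrite (leW_mono vm).
- by move: (Hr i j ik j0); case: (Hp i) (Hp j) => _ -> _ [_ _ ->]; rewrite rr'.
- by case: (Hp i); rewrite -surjective_pairing.
Qed.

(** This serves both for the shift by one and for the embedding of a subset. The last hypothesis
    provides surjectivity: an admissible [A] is the image of its preimage. *)
Lemma card_diagram_map (d d' : Order.disp_t) (T : finOrderType d)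
    (T' : finOrderType d') (k : nat) (u v : T -> T') (r : rel T) (r' : rel T')
    (Q : pred {set T * T}) (Q' : pred {set T' * T'}) :
  {mono u : x y / x <= y} -> {mono v : x y / x <= y} ->
  (forall x y, r' (u x) (v y) = r x y) ->
  (forall W, Q' (map_arcs u v W) = Q W) ->
  (forall A, diagram r' A -> Q' A ->
     forall x y, (x, y) \in A -> exists x0 y0, x = u x0 /\ y = v y0) ->
  #|[set A | [&& diagram r' A, ~~ kcrossing k r' A & Q' A]]| =
  #|[set W | [&& diagram r W, ~~ kcrossing k r W & Q W]]|.
Proof.
move=> um vm rr' QQ' im.
have uI := inc_inj um.
have vI := inc_inj vm.
have mI : injective (map_arcs u v).
  by apply: imset_inj => -[x y] [z t] /= [/uI-> /vI->].
rewrite -[RHS](card_imset _ mI); apply: eq_card => A; rewrite inE.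
apply/idP/imsetP => [/and3P[dA kA QA]|[W + ->]]; last first.
  rewrite inE -(kcrossing_map k W um vm rr') -(diagram_map W uI vI rr').
  by rewrite QQ'.
pose W := [set p | (u p.1, v p.2) \in A].
have AE : A = map_arcs u v W.
  apply/setP=> -[x y]; apply/idP/imsetP => [Axy|[p + ->]]; last by rewrite inE.
  have [x0 [y0 [xE yE]]] := im _ dA QA _ _ Axy.
  by exists (x0, y0); rewrite /= -?xE -?yE // inE /= -xE -yE.
exists W => //; rewrite inE -(kcrossing_map k W um vm rr').
by rewrite -(diagram_map W uI vI rr') -QQ' -AE dA kA.
Qed.

(** * The two counts and the binomial sum *)

Lemma classical_noncrossing_countE (k n : nat) :
  classical_noncrossing_count k n.+1 =
  #|[set W : {set 'I_n * 'I_n} | diagram <=%O W & ~~ kcrossing k <=%O W]|.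
Proof.
rewrite /classical_noncrossing_count.
rewrite (@card_partition_arcs _ _ _ (fun A => ~~ kcrossing k <%O A)); last first.
  by move=> P _; rewrite has_classical_crossingE.
transitivity #|[set A : {set 'I_n.+1 * 'I_n.+1} |
    [&& diagram <%O A, ~~ kcrossing k <%O A & true]]|.
  by apply: eq_card => A; rewrite !inE andbT.
(* [lift ord_max] keeps the value of a left end and [lift ord0] adds one to a right end; x < y + 1
   means x <= y. *)
rewrite (@card_diagram_map _ _ 'I_n 'I_n.+1 k (lift ord_max) (lift ord0)
  <=%O <%O xpredT) //.
- by apply: eq_card => A; rewrite !inE andbT.
- by move=> x y; rewrite !leEord !lift_max.
- by move=> x y; rewrite leEord ltEord lift_max lift0 ltnS.
(* The top point starts no arc and 0 ends none, so every arc is in the image. *)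
move=> A /diagramP[ltA _ _] _ x y /ltA.
case: (unliftP ord_max x) => [x0|] ->; last by rewrite ltEord /= ltnNge -ltnS ltn_ord.
by case: (unliftP ord0 y) => [y0|] -> // _; exists x0, y0.
Qed.

(** With loops for singletons, partitions become weak diagrams of full support; the increasing
    enumeration of [S] carries these to the diagrams on ['I_n] whose support is [S]. *)
Lemma enhanced_noncrossing_countE (k n : nat) (S : {set 'I_n}) :
  enhanced_noncrossing_count k #|S| =
  #|[set W : {set 'I_n * 'I_n} |
      [&& diagram <=%O W, ~~ kcrossing k <=%O W & support W == S]]|.
Proof.
rewrite /enhanced_noncrossing_count.
rewrite (@card_partition_arcs _ _ _
  (fun A => ~~ kcrossing k <=%O (add_loops A))); last first.
  by move=> P pP; rewrite has_enhanced_crossingE.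
rewrite (card_full_diagram (fun W => ~~ kcrossing k <=%O W)).
pose f : 'I_#|S| -> 'I_n := @Order.enum_val _ 'I_n (mem S).
have fm : {mono f : x y / x <= y} by apply: Order.le_enum_val; apply: le_total.
have fI : injective f := inc_inj fm.
have fS x : x \in S -> exists i, x = f i.
  by move=> xS; exists (Order.enum_rank_in xS x); rewrite /f Order.enum_rankK_in.
apply/esym; apply: (@card_diagram_map _ _ _ _ _ f f) => //.
  move=> W; apply/eqP/eqP => sW.
    apply/setP=> i; rewrite [RHS]inE; have: f i \in support (map_arcs f f W).
      by rewrite sW; apply: Order.enum_valP.
    case/supportP=> y [|] /imsetP[[a b] Wab [/= E1 E2]].
      by rewrite (fI _ _ E1); apply: mem_supportl Wab.
    by rewrite (fI _ _ E2); apply: mem_supportr Wab.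
  apply/setP=> x; apply/supportP/idP => [[y]|/fS[i ->]].
    by case=> /imsetP[p _ [xE yE]]; [rewrite xE|rewrite yE]; apply: Order.enum_valP.
  have: i \in support W by rewrite sW in_setT.
  by case/supportP=> y Wy; exists (f y); rewrite !mem_map_arcs.
move=> A _ /eqP sA x y Axy.
have /fS[x0 xE] : x \in S by rewrite -sA; apply: mem_supportl Axy.
have /fS[y0 yE] : y \in S by rewrite -sA; apply: mem_supportr Axy.
by exists x0, y0.
Qed.

Local Close Scope order_scope.

Theorem theorem1 (n k : nat) (hk : 1 <= k) :
  classical_noncrossing_count k n.+1 =
    \sum_(i < n.+1) 'C(n, i) * enhanced_noncrossing_count k i.
Proof.
rewrite classical_noncrossing_countE -sum1_card.
(* The weak diagrams are sorted by their support. *)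
rewrite (partition_big (@support _) xpredT) //=.
transitivity (\sum_(S : {set 'I_n}) enhanced_noncrossing_count k #|S|).
  apply: eq_bigr => S _; rewrite enhanced_noncrossing_countE -sum1_card.
  by apply: eq_bigl => W; rewrite !inE andbA.
have card_le (S : {set 'I_n}) : #|S| < n.+1 by rewrite ltnS -[n in _ <= n]card_ord max_card.
(* The subsets are grouped by size; the summand is constant on each group, and [card_draws] counts
   the subsets of size [i]. *)
rewrite (partition_big (fun S : {set 'I_n} => Ordinal (card_le S)) xpredT) //=.
apply: eq_bigr => i _; rewrite -[n in 'C(n, _)]card_ord -card_draws -sum_nat_const.
by apply: congr_big => // S; rewrite ?inE // => /eqP <-.
Qed.
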